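(* Let $f:\mathbb{R}^d\to\mathbb{R}$ be $(L_0,L_1)$-smooth, and let the stochastic gradient oracle be unbiased and satisfy the strong growth condition with constant $\rho\ge 1$, i.e. $\mathbb{E}_\xi[\|\nabla f(x,\xi)\|^2]\le \rho\|\nabla f(x)\|^2$ for all $x\in\mathbb{R}^d$. Then ClipSGD with clipping radius $c>0$, constant step size $0<\eta\le [9(L_0+L_1c)]^{-1}$ and batch size $B\ge 72(\rho-1)$ guarantees, after $N\geq 1$ iterations, $$\min_{k\in\{0,\dots,N-1\}}\mathbb{E}\big[\|\nabla f(x^k)\|\big]\le \sqrt{\frac{18F_0}{\eta N}}+\frac{18F_0}{\eta cN},$$ where $F_0=f(x^0)-f^*$.
   Context: Setting: $f(x)=\mathbb{E}_{\xi\sim\mathcal D}[f(x,\xi)]$ is differentiable on $\mathbb{R}^d$, possibly non-convex, $f^*=\min_{x\in\mathbb{R}^d} f(x)$, and $\|\cdot\|$ is the Euclidean norm. The oracle returns stochastic gradients $\nabla f(x,\xi)$, $\xi\sim\mathcal D$. $(L_0,L_1)$-smoothness ($L_0,L_1\ge 0$): for all $x,y\in\mathbb{R}^d$ with $\|y-x\|\le 1/L_1$, $\|\nabla f(y)-\nabla f(x)\|\le (L_0+L_1\|\nabla f(x)\|)\|y-x\|$ (with $1/L_1=+\infty$ if $L_1=0$). Unbiasedness: $\mathbb{E}_\xi[\nabla f(x,\xi)]=\nabla f(x)$ for all $x$. ClipSGD: given $x^0\in\mathbb{R}^d$, integer batch size $B\ge1$, $\eta>0$, $c>0$; at iteration $k$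 draw fresh i.i.d. samples $\xi_1^k,\dots,\xi_B^k\sim\mathcal D$ (independent of the past), form $g^k=\frac1B\sum_{i=1}^B\nabla f(x^k,\xi_i^k)$, and set $x^{k+1}=x^k-\eta\,\min\{1,c/\|g^k\|\}\,g^k$ (the factor is $1$ if $g^k=0$). *)

(* Defs.v *)
From HB Require Import structures.
From mathcomp Require Import all_boot all_order all_algebra.
From mathcomp Require Import all_classical all_reals all_analysis.
Set Implicit Arguments.
Unset Strict Implicit.
Unset Printing Implicit Defensive.
Import Order.TTheory GRing.Theory Num.Theory numFieldNormedType.Exports.
Local Open Scope classical_set_scope.
Local Open Scope ring_scope.

(* The library norm `|x| on 'rV[R]_d is the sup norm, hence this definition. *)
Definition l2norm (R : realType) (d : nat) (x : 'rV[R]_d) : R :=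
  Num.sqrt (\sum_(i < d) x 0 i ^+ 2).

Definition grad (R : realType) (d : nat) (f : 'rV[R]_d -> R) (x : 'rV[R]_d) :
    'rV[R]_d :=
  \row_(i < d) 'D_(delta_mx 0 i) f x.

(* The inverse of extended reals satisfies 0^-1 = +oo, so that the locality
   constraint disappears when L1 = 0. *)
Definition L0L1_smooth (R : realType) (d : nat) (L0 L1 : R)
    (f : 'rV[R]_d -> R) : Prop :=
  forall x y : 'rV[R]_d, ((l2norm (y - x))%:E <= (L1%:E)^-1)%E ->
    l2norm (grad f y - grad f x) <=
      (L0 + L1 * l2norm (grad f x)) * l2norm (y - x).

Definition is_minimum (R : realType) (T : Type) (f : T -> R) (m : R) : Prop :=
  (exists x, f x = m) /\ (forall x, m <= f x).

(* R^d with its Borel sigma-algebra. *)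
Definition borel_rV (R : realType) (d : nat) :=
  g_sigma_algebraType (@open 'rV[R]_d).

(* Measurability in (x, xi) jointly makes the iterates, and the stochastic
   gradients evaluated at them, random variables. *)
Definition jointly_measurable (R : realType) (d : nat) (dX : measure_display)
    (Xi : measurableType dX) (G : 'rV[R]_d -> Xi -> 'rV[R]_d) : Prop :=
  forall i : 'I_d,
    measurable_fun setT (fun p : borel_rV R d * Xi => G p.1 p.2 0 i).

Section oracle.
Context (R : realType) (d : nat) (dX : measure_display)
  (Xi : measurableType dX) (D : probability Xi R).
Implicit Types (f : 'rV[R]_d -> R) (F : 'rV[R]_d -> Xi -> R)
  (G : 'rV[R]_d -> Xi -> 'rV[R]_d).

Definition is_expected_loss F f : Prop :=
  forall x, D.-integrable setT (EFin \o F x) /\ ('E_D[F x] = (f x)%:E)%E.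

(* G is a jointly measurable version of (x, xi) |-> grad_x F(x, xi). *)
Definition is_stochastic_gradient F G : Prop :=
  jointly_measurable G /\
  forall x, {ae D, forall s,
    differentiable (F ^~ s) x /\ G x s = grad (F ^~ s) x}.

Definition unbiased f G : Prop :=
  forall x (i : 'I_d),
    D.-integrable setT (fun s => (G x s 0 i)%:E) /\
    ('E_D[fun s => (G x s 0 i)%R] = (grad f x 0 i)%:E)%E.

Definition strong_growth (rho : R) f G : Prop :=
  forall x, ('E_D[fun s => (l2norm (G x s) ^+ 2)%R] <=
             (rho * l2norm (grad f x) ^+ 2)%:E)%E.

End oracle.

Definition mutually_independent (R : realType) (dO dX : measure_display)
    (Omega : measurableType dO) (P : probability Omega R)
    (Xi : measurableType dX) (I : eqType) (X : I -> Omega -> Xi) : Prop :=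
  forall (s : seq I) (A : I -> set Xi), uniq s ->
    (forall j, measurable (A j)) ->
    (P (\bigcap_(j in [set` s]) (X j @^-1` A j)) =
     \prod_(j <- s) P (X j @^-1` A j))%E.

Definition has_law (R : realType) (dO dX : measure_display)
    (Omega : measurableType dO) (P : probability Omega R)
    (Xi : measurableType dX) (X : {RV P >-> Xi}) (D : probability Xi R) : Prop :=
  forall A, measurable A -> distribution P X A = D A.

(* All samples of all iterations form one i.i.d. family: as x^0 is
   deterministic, this is exactly that each batch is i.i.d. and independent of
   the past. *)
Definition iid_samples (R : realType) (dO dX : measure_display)
    (Omega : measurableType dO) (P : probability Omega R)
    (Xi : measurableType dX) (D : probability Xi R) (B : nat)
    (xi : nat -> 'I_B -> {RV P >-> Xi}) : Prop :=
  (forall k i, has_law (xi k i) D) /\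
  mutually_independent P
    (fun ki : (nat * 'I_B)%type => (xi ki.1 ki.2 : Omega -> Xi)).

Definition clip_factor (R : realType) (d : nat) (c : R) (g : 'rV[R]_d) : R :=
  if g == 0 then 1 else Num.min 1 (c / l2norm g).

Definition batch_grad (R : realType) (d : nat) (Xi : Type)
    (G : 'rV[R]_d -> Xi -> 'rV[R]_d) (B : nat) (x : 'rV[R]_d)
    (s : 'I_B -> Xi) : 'rV[R]_d :=
  B%:R^-1 *: \sum_(i < B) G x (s i).

Fixpoint clipSGD (R : realType) (d : nat) (Xi : Type)
    (G : 'rV[R]_d -> Xi -> 'rV[R]_d) (eta c : R) (B : nat) (x0 : 'rV[R]_d)
    (s : nat -> 'I_B -> Xi) (k : nat) : 'rV[R]_d :=
  if k is k'.+1 then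
    let x := clipSGD G eta c x0 s k' in
    let g := batch_grad G x (s k') in
    x - (eta * clip_factor c g) *: g
  else x0.

(* Main.v *)
Require Import Defs.
From HB Require Import structures.
From mathcomp Require Import all_boot all_order all_algebra.
From mathcomp Require Import all_classical all_reals all_analysis.
From mathcomp Require Import measurable_realfun.
From mathcomp Require Import ring lra.
Import Order.TTheory GRing.Theory Num.Theory numFieldNormedType.Exports.
Local Open Scope classical_set_scope.
Local Open Scope ring_scope.

(** Write a(x) for the Euclidean norm of the gradient of f at x, and let
phi(x) = min(a(x)^2, c a(x)). The proof compares the loss before and after one
step, and phi is the decrease that clipping lets through: quadratic where the
gradient is short, only linear where it is long.

_A step at a frozen point._ A clipped step has length at most eta c, hence at
most 1 / (9 L1), so that the smoothness inequality applies between its two ends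
and the mean value theorem gives a descent inequality. Let u be the batch
gradient and s its distance to the true gradient. Clipping preserves the
direction of u; when s is small compared with a, u is nearly parallel to the
gradient, and when s is not small, the error term is allowed to be of order
s^2. Both regimes are covered by one inequality that holds for every u
([clipped_descent]):
  f(x+) + (5/8) eta phi(x) <= f(x) + 9 eta (phi(x) / a(x)^2) s^2.
The factor phi / a^2 is [shrink c a] = c / max(c, a), which is also the clipping
factor of a vector of norm a.

The strong growth condition bounds the variance of one sample by (rho - 1) a^2,
and averaging B pairwise independent samples divides it by B
([batch_variance]). As B >= 72 (rho - 1), the mean of s^2 is at most a^2 / 72,
and the error costs at most eta phi / 8: the expected decrease is at least
eta phi(x) / 2 ([expected_descent]).

_From frozen points to iterates._ The k-th iterate is a function of the batches
of index less than k, which are independent of the k-th batch. The joint law of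
the iterate and of its batch is therefore a product, and by Tonelli the
expectation of a nonnegative function of the next iterate is an iterated
integral in which the current iterate is frozen ([expectation_next]). All
quantities integrated this way are nonnegative, so that no integrability has to
be established along the trajectory.

_Conclusion._ Telescoping bounds the sum over k < N of E phi(x_k) by
2 F0 / eta. For every t > 0,
  a <= (1 / (2t) + 1 / c) phi + t / 2,
by the inequality of arithmetic and geometric means if a <= c and since
a = phi / c otherwise ([le_shrink_sqr]). Averaging over k and letting t
approach sqrt (18 F0 / (eta N)) from above gives the claim; the approach from
above also covers F0 = 0. *)

(** * Euclidean geometry of row vectors *)

Definition dot {R : realType} {d : nat} (u v : 'rV[R]_d) : R :=
  \sum_(i < d) u 0 i * v 0 i.

Section euclidean.
Context {R : realType} {d : nat}.
Implicit Types u v : 'rV[R]_d.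

Lemma l2norm_ge0 u : 0 <= l2norm u.
Proof. exact: sqrtr_ge0. Qed.

Lemma l2norm_sqr u : l2norm u ^+ 2 = \sum_(i < d) u 0 i ^+ 2.
Proof. by rewrite /l2norm sqr_sqrtr// sumr_ge0// => i _; rewrite sqr_ge0. Qed.

Lemma dotuu u : dot u u = l2norm u ^+ 2.
Proof. by rewrite l2norm_sqr; apply: eq_bigr => i _; rewrite expr2. Qed.

Lemma dotC u v : dot u v = dot v u.
Proof. by apply: eq_bigr => i _; rewrite mulrC. Qed.

Lemma dotDl u v w : dot (u + v) w = dot u w + dot v w.
Proof.
by rewrite /dot -big_split/=; apply: eq_bigr => i _; rewrite mxE mulrDl.
Qed.

Lemma dotZl (a : R) u v : dot (a *: u) v = a * dot u v.
Proof. by rewrite /dot mulr_sumr; apply: eq_bigr => i _; rewrite mxE mulrA. Qed.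

Lemma dotDr u v w : dot w (u + v) = dot w u + dot w v.
Proof. by rewrite dotC dotDl !(dotC w). Qed.

Lemma dotZr (a : R) u v : dot u (a *: v) = a * dot u v.
Proof. by rewrite dotC dotZl dotC. Qed.

Lemma l2normZ (a : R) u : l2norm (a *: u) = `|a| * l2norm u.
Proof.
apply/eqP; rewrite -(eqrXn2 (n := 2))// ?mulr_ge0 ?l2norm_ge0//.
by rewrite exprMn real_normK ?num_real// -!dotuu dotZl dotZr mulrA expr2.
Qed.

Lemma l2norm0 : l2norm (0 : 'rV[R]_d) = 0.
Proof. by rewrite -(scale0r (0 : 'rV[R]_d)) l2normZ normr0 mul0r. Qed.

Lemma l2norm_eq0 u : l2norm u = 0 -> u = 0.
Proof.
move=> u0; have /eqP : l2norm u ^+ 2 = 0 by rewrite u0 expr0n.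
rewrite l2norm_sqr psumr_eq0; last by move=> i _; rewrite sqr_ge0.
move/allP => h; apply/rowP => i; rewrite mxE.
by have := h i (mem_index_enum _); rewrite sqrf_eq0 => /eqP.
Qed.

Lemma dot0l v : dot 0 v = 0.
Proof. by rewrite -(scale0r (0 : 'rV[R]_d)) dotZl mul0r. Qed.

(** The vector |v| u - |u| v has a nonnegative square, and that square is
2 |u| |v| (|u| |v| - dot u v). *)
Lemma cauchy_schwarz u v : dot u v <= l2norm u * l2norm v.
Proof.
have [u0|u0] := eqVneq (l2norm u) 0.
  by rewrite (l2norm_eq0 _ u0) dot0l mulr_ge0 ?l2norm_ge0.
have [v0|v0] := eqVneq (l2norm v) 0.
  by rewrite (l2norm_eq0 _ v0) dotC dot0l mulr_ge0 ?l2norm_ge0.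
have ugt : 0 < l2norm u by rewrite lt_neqAle eq_sym u0 l2norm_ge0.
have vgt : 0 < l2norm v by rewrite lt_neqAle eq_sym v0 l2norm_ge0.
set a := l2norm u in ugt *; set b := l2norm v in vgt *.
have : 0 <= dot (b *: u + (- a) *: v) (b *: u + (- a) *: v).
  by rewrite dotuu sqr_ge0.
rewrite !(dotDl, dotDr, dotZl, dotZr) !dotuu -/a -/b (dotC v u).
rewrite (_ : _ + _ = 2 * (a * b) * (a * b - dot u v)); last by ring.
by rewrite pmulr_rge0 ?subr_ge0// mulr_gt0 ?mulr_gt0.
Qed.

Lemma ler_l2normD u v : l2norm (u + v) <= l2norm u + l2norm v.
Proof.
rewrite -(ler_pXn2r (n := 2))// ?nnegrE ?addr_ge0 ?l2norm_ge0//.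
rewrite -dotuu dotDl !dotDr !dotuu (dotC v u) sqrrD mulr2n.
by have := cauchy_schwarz u v; lra.
Qed.

Lemma l2normN u : l2norm (- u) = l2norm u.
Proof. by rewrite -scaleN1r l2normZ normrN1 mul1r. Qed.

End euclidean.

(** * Descent along a gradient step *)

(** The inverse of 0 is +oo, which agrees with the product form of the bound:
a constraint with a = 0 is void in both. *)
Lemma lee_inve {R : realType} (a e : R) : 0 <= a ->
  (e%:E <= (a%:E)^-1)%E = (e * a <= 1).
Proof.
move=> a0; have [->|an0] := eqVneq a 0; first by rewrite inve0 leey mulr0 ler01.
rewrite inver (negbTE an0) lee_fin -[_^-1]mul1r ler_pdivlMr//.
by rewrite lt_neqAle eq_sym an0.
Qed.

Section gradient_step.
Context {R : realType} {d : nat}.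
Implicit Types (f : 'rV[R]_d -> R) (x u v : 'rV[R]_d).

Lemma derive_dot_grad f x v : differentiable f x -> 'D_v f x = dot (grad f x) v.
Proof.
move=> fx; rewrite deriveE// {1}(row_sum_delta v) linear_sum/=.
by apply: eq_bigr => i _; rewrite linearZ/= -deriveE// mxE mulrC.
Qed.

(** The mean value theorem for the restriction of f to a line, whose derivative
is a directional derivative of f. *)
Lemma segment_mvt f x v : (forall y, differentiable f y) ->
  exists2 t, 0 <= t <= 1 & f (x + v) - f x = dot (grad f (x + t *: v)) v.
Proof.
move=> df; pose phi (t : R) := f (x + t *: v).
have dphi (t : R) : is_derive t (1 : R) phi (dot (grad f (x + t *: v)) v).
  (* the difference quotient of phi in direction 1 is that of f in direction v *)
  have shiftE : (fun h : R => h^-1 *: ((phi \o shift t) (h *: (1 : R)) - phi t)) =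
      (fun h : R => h^-1 *: ((f \o shift (x + t *: v)) (h *: v) - f (x + t *: v))).
    by apply/funext => h; rewrite /phi /= [h *: (1 : R)]mulr1 scalerDl addrCA.
  apply: DeriveDef.
    by rewrite /derivable shiftE; exact: diff_derivable.
  by rewrite /derive shiftE; exact: derive_dot_grad.
have cphi : {within `[0, 1], continuous phi}.
  apply: derivable_within_continuous => t _.
  by have [] := dphi t.
have [t t01] := @MVT_segment R phi _ 0 1 ler01 (fun t _ => dphi t) cphi.
rewrite /phi scale1r scale0r addr0 subr0 mulr1 => ->.
by exists t => //; move: t01; rewrite in_itv.
Qed.

(** The gradient at an intermediate point differs from the one at x by at most
(L0 + L1 |grad f x|) |v|. Integrating along the segment would halve the
quadratic term; the mean value theorem is enough for the constants below. *)
Lemma L0L1_smooth_descent f (L0 L1 : R) x v : (forall y, differentiable f y) ->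
  0 <= L0 -> 0 <= L1 -> L0L1_smooth L0 L1 f -> L1 * l2norm v <= 1 ->
  f (x + v) - f x <=
    dot (grad f x) v + (L0 + L1 * l2norm (grad f x)) * l2norm v ^+ 2.
Proof.
move=> df L00 L10 smooth Lv; have [t /andP[t0 t1] ->] := segment_mvt f x v df.
set y := x + t *: v.
have yx : l2norm (y - x) <= l2norm v.
  by rewrite /y addrAC subrr add0r l2normZ ger0_norm// ler_piMl// l2norm_ge0.
have gyx : l2norm (grad f y - grad f x) <=
    (L0 + L1 * l2norm (grad f x)) * l2norm v.
  apply: le_trans (smooth x y _) _; last first.
    by rewrite ler_wpM2l// addr_ge0// mulr_ge0// l2norm_ge0.
  by rewrite lee_inve// mulrC; apply: le_trans Lv; rewrite ler_wpM2l.
rewrite -[grad f y](subrK (grad f x)) addrC dotDl lerD2l.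
apply: le_trans (cauchy_schwarz _ _) _.
by rewrite expr2 mulrA ler_wpM2r// l2norm_ge0.
Qed.

End gradient_step.

(** * Clipping *)

(** The factor min(1, c / a) in a form that is continuous in a and equals 1 at
a = 0. It serves both as the clipping factor of a vector of norm a and as the
ratio of min(a^2, c a) to a^2. *)
Definition shrink {R : realType} (c a : R) : R := c / Num.max c a.

Section clipping.
Context {R : realType}.
Implicit Types c a r s p : R.

Lemma shrink_le c a : 0 < c -> a <= c -> shrink c a = 1.
Proof. by move=> c0 ac; rewrite /shrink max_l// divff// gt_eqF. Qed.

Lemma shrink_ge c a : c <= a -> shrink c a = c / a.
Proof. by move=> ca; rewrite /shrink max_r. Qed.

Lemma shrink_ge0 c a : 0 < c -> 0 <= shrink c a.
Proof. by move=> c0; rewrite divr_ge0 ?ltW// lt_max c0. Qed.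

Lemma shrink_le1 c a : 0 < c -> shrink c a <= 1.
Proof. by move=> c0; rewrite ler_pdivrMr ?mul1r ?le_max ?lexx// lt_max c0. Qed.

Lemma shrink_mul_le c a : 0 < c -> 0 <= a -> shrink c a * a <= c.
Proof.
move=> c0 a0; rewrite mulrAC ler_pdivrMr ?lt_max ?c0// ler_pM2l//.
by rewrite le_max lexx orbT.
Qed.

Lemma clip_factorE d c (u : 'rV[R]_d) : 0 < c ->
  clip_factor c u = shrink c (l2norm u).
Proof.
move=> c0; rewrite /clip_factor; case: eqP => [->|/eqP u0].
  by rewrite shrink_le// l2norm0 ltW.
have ugt : 0 < l2norm u.
  by rewrite lt_neqAle l2norm_ge0 andbT eq_sym; apply: contra_neq u0 => /l2norm_eq0.
have [uc|cu] := leP (l2norm u) c.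
  by rewrite shrink_le// min_l// ler_pdivlMr// mul1r.
by rewrite shrink_ge ?ltW// min_r// ler_pdivrMr// mul1r ltW.
Qed.

(** Here a is the norm of the gradient g, r the norm of its estimate u, s that of
u - g, and p = dot g u; the last three hypotheses are the triangle inequality
and two instances of the Cauchy-Schwarz inequality. The clipped estimate keeps
a correlation with g of at least min(a, c) (a - 2 s). If u is clipped, p / r is
at least r - s and hence at least a - 2 s; if it is not, p >= a^2 - a s. The
remaining cases are those where a - 2 s is negative. *)
Lemma shrink_correlation c a r s p :
  0 < c -> 0 <= a -> 0 <= r -> 0 <= s -> a <= r + s ->
  a ^+ 2 - a * s <= p -> r ^+ 2 - r * s <= p ->
  shrink c a * (a * (a - 2 * s)) <= shrink c r * p.
Proof.
move=> c0 a0 r0 s0 ars pa pr.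
have [ac|ca] := leP a c; have [rc|cr] := leP r c.
- rewrite !shrink_le// !mul1r; apply: le_trans pa.
  have := mulr_ge0 a0 s0; lra.
- rewrite (shrink_le c a)// (shrink_ge _ _ (ltW cr)) mul1r.
  have rgt0 : 0 < r by lra.
  have tp : c * (r - s) <= c / r * p.
    rewrite (_ : c * (r - s) = c / r * (r ^+ 2 - r * s)); last by field; lra.
    by rewrite ler_wpM2l// divr_ge0// ltW.
  have [as0|as0] := leP a (2 * s); last first.
    apply: le_trans tp; apply: ler_pM; rewrite ?subr_ge0//; lra.
  have t0 : 0 <= c / r by rewrite divr_ge0// ltW.
  have t1 : c / r <= 1 by rewrite ler_pdivrMr// mul1r ltW.
  have tpa : c / r * (a ^+ 2 - a * s) <= c / r * p by rewrite ler_wpM2l.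
  apply: le_trans tpa; have [sa|sa] := leP s a.
    have h1 : a * (a - 2 * s) <= 0 by rewrite mulr_ge0_le0// subr_le0.
    by rewrite (le_trans h1)// mulr_ge0// subr_ge0 expr2 ler_wpM2l.
  have h1 : 0 <= a * (s - a) by rewrite mulr_ge0// subr_ge0 ltW.
  have h2 : 0 <= a * s by rewrite mulr_ge0.
  have h3 : c / r * (a * (s - a)) <= a * (s - a) by rewrite ler_piMl.
  move: h3; rewrite (_ : a ^+ 2 - a * s = - (a * (s - a))); last by ring.
  by rewrite mulrN; lra.
- rewrite (shrink_le c r)// mul1r (shrink_ge _ _ (ltW ca)).
  rewrite (_ : c / a * _ = c * (a - 2 * s)); last by field; lra.
  have [sa|sa] := leP s a.
    have : 0 <= (a - c) * (a - s).
      by apply: mulr_ge0; rewrite subr_ge0//; exact: ltW.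
    have : 0 <= c * s by rewrite mulr_ge0// ltW.
    by move: pa; lra.
  have [sr|sr] := leP s r.
    have : 0 <= r * (r - s) by rewrite mulr_ge0// subr_ge0.
    have : 0 <= c * (2 * s - a) by rewrite mulr_ge0; lra.
    by move: pr; lra.
  have : 0 <= (c - r) * (s - r).
    by apply: mulr_ge0; rewrite subr_ge0//; exact: ltW.
  have : 0 <= c * (s - a).
    by apply: mulr_ge0; rewrite ?subr_ge0; exact: ltW.
  have : 0 <= c * r by rewrite mulr_ge0// ltW.
  by move: pr; lra.
- rewrite (shrink_ge _ _ (ltW ca)) (shrink_ge _ _ (ltW cr)).
  have rgt0 : 0 < r by lra.
  rewrite (_ : c / a * _ = c * (a - 2 * s)); last by field; lra.
  have tp : c * (r - s) <= c / r * p.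
    rewrite (_ : c * (r - s) = c / r * (r ^+ 2 - r * s)); last by field; lra.
    by rewrite ler_wpM2l// divr_ge0// ltW.
  by apply: le_trans tp; rewrite ler_pM2l//; lra.
Qed.

(** Second-order term of the descent inequality. If a <= c, the step size makes
eta (L0 + L1 a) at most 1/9 and the clipped norm is at most r <= a + s; if
a > c, that coefficient can be as large as a / (9 c), but the clipped norm is
at most c. *)
Lemma shrink_curvature c a r s (L0 L1 eta : R) :
  0 < c -> 0 <= a -> 0 <= r -> 0 <= s -> r <= a + s ->
  0 <= L0 -> 0 <= L1 -> 0 < eta -> eta * (9 * (L0 + L1 * c)) <= 1 ->
  eta * (L0 + L1 * a) * (shrink c r * r) ^+ 2 <=
    shrink c a * (2 / 9 * (a ^+ 2 + s ^+ 2)).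
Proof.
move=> c0 a0 r0 s0 ras L00 L10 eta0 etaL.
have hr0 : 0 <= shrink c r * r by rewrite mulr_ge0// shrink_ge0.
have eLa0 : 0 <= eta * (L0 + L1 * a).
  by rewrite mulr_ge0 ?addr_ge0// ?mulr_ge0//; exact: ltW.
have hc : shrink c r * r <= c by exact: shrink_mul_le.
have hr : shrink c r * r <= r by rewrite ler_piMl// shrink_le1.
have [ac|ca] := leP a c.
  rewrite (shrink_le c a)// mul1r.
  have eL : eta * (L0 + L1 * a) <= 1 / 9.
    have : eta * (L0 + L1 * a) <= eta * (L0 + L1 * c).
      by rewrite ler_pM2l// lerD2l ler_wpM2l.
    by lra.
  have h2 : (shrink c r * r) ^+ 2 <= 2 * (a ^+ 2 + s ^+ 2).
    apply: (@le_trans _ _ ((a + s) ^+ 2)).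
      by rewrite ler_pXn2r ?nnegrE ?addr_ge0// (le_trans hr).
    by have := sqr_ge0 (a - s); lra.
  have := ler_pM eLa0 (sqr_ge0 _) eL h2.
  by lra.
rewrite (shrink_ge c a (ltW ca)).
have agt0 : 0 < a by lra.
have eL : eta * (L0 + L1 * a) <= a / c / 9.
  rewrite (_ : a / c / 9 = a / (9 * c)); last by field; lra.
  rewrite ler_pdivlMr ?mulr_gt0//.
  have -> : eta * (L0 + L1 * a) * (9 * c) = eta * (9 * (L0 * c + L1 * c * a)) by ring.
  have : eta * (9 * (L0 * c + L1 * c * a)) <= eta * (9 * (L0 + L1 * c)) * a.
    rewrite [leRHS](_ : _ = eta * (9 * (L0 * a + L1 * c * a))); last by ring.
    by rewrite !ler_pM2l// lerD2r ler_wpM2l// ltW.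
  by move=> /le_trans; apply; rewrite -[leRHS]mul1r ler_wpM2r.
have h2 : (shrink c r * r) ^+ 2 <= c ^+ 2 by rewrite ler_pXn2r// nnegrE ltW.
have := ler_pM eLa0 (sqr_ge0 _) eL h2.
move=> /le_trans; apply.
rewrite (_ : a / c / 9 * c ^+ 2 = c / a * (a ^+ 2 / 9)); last first.
  by field; apply/andP; split; lra.
have ca0 : 0 < c / a by rewrite divr_gt0.
rewrite ler_pM2l//.
by have := sqr_ge0 a; have := sqr_ge0 s; lra.
Qed.

End clipping.

Section clipped_step.
Context {R : realType} {d : nat}.
Implicit Types (f : 'rV[R]_d -> R) (x u v : 'rV[R]_d).

(** Combination of the two previous bounds with 2 a s <= a^2 / 8 + 8 s^2: the
coefficient of a^2 is 1 - 1/8 - 2/9 >= 5/8, and that of s^2 is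
8 + 2/9 <= 9. *)
Lemma clipped_descent f (L0 L1 eta c : R) x u :
  (forall y, differentiable f y) ->
  0 <= L0 -> 0 <= L1 -> L0L1_smooth L0 L1 f ->
  0 < c -> 0 < eta -> eta * (9 * (L0 + L1 * c)) <= 1 ->
  f (x - (eta * clip_factor c u) *: u) +
    eta * (shrink c (l2norm (grad f x)) * (5 / 8 * l2norm (grad f x) ^+ 2)) <=
  f x + eta * (shrink c (l2norm (grad f x)) * (9 * l2norm (u - grad f x) ^+ 2)).
Proof.
move=> df L00 L10 smooth c0 eta0 etaL; rewrite clip_factorE//.
set a := l2norm (grad f x).
set g := grad f x; set s := l2norm (u - g); set r := l2norm u.
set h := shrink c r.
have a0 : 0 <= a by exact: l2norm_ge0.
have r0 : 0 <= r by exact: l2norm_ge0.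
have s0 : 0 <= s by exact: l2norm_ge0.
have h0 : 0 <= h by exact: shrink_ge0.
have q0 : 0 <= shrink c a by exact: shrink_ge0.
have ars : a <= r + s.
  rewrite /a -/g -[g](subrK u) addrC (le_trans (ler_l2normD _ _))//.
  by rewrite lerD2l -l2normN opprB.
have ras : r <= a + s.
  by rewrite /r -[u](subrK g) addrC (le_trans (ler_l2normD _ _)).
have cs w : - (l2norm w * s) <= dot w (u - g).
  rewrite lerNl -mulN1r -dotZl.
  by rewrite (le_trans (cauchy_schwarz _ _))// l2normZ normrN1 mul1r.
have pa : a ^+ 2 - a * s <= dot g u.
  have -> : dot g u = a ^+ 2 + dot g (u - g) by rewrite -dotuu -dotDr subrKC.
  by rewrite lerD2l cs.
have pr : r ^+ 2 - r * s <= dot g u.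
  have -> : dot g u = r ^+ 2 + dot u (g - u).
    by rewrite -dotuu -dotDr subrKC dotC.
  rewrite lerD2l -(opprB u g) -[X in dot u X]scaleN1r dotZr mulN1r lerN2.
  exact: cauchy_schwarz.
have corr := shrink_correlation c a r s (dot g u) c0 a0 r0 s0 ars pa pr.
have curv := shrink_curvature c a r s L0 L1 eta c0 a0 r0 s0 ras L00 L10 eta0 etaL.
have hc : h * r <= c by exact: shrink_mul_le.
have D0 := L0L1_smooth_descent f L0 L1 x (- (eta * h) *: u) df L00 L10 smooth.
move: D0; have eh0 : 0 <= eta * h by rewrite mulr_ge0// ltW.
rewrite l2normZ normrN ger0_norm// -/r scaleNr => /(_ _)/wrap[].
  have : L1 * (eta * h * r) <= L1 * (eta * c).
    by rewrite ler_wpM2l// -mulrA ler_pM2l.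
  have : 0 <= eta * L0 by rewrite mulr_ge0// ltW.
  have : 0 <= eta * (L1 * c) by rewrite mulr_ge0 ?mulr_ge0// ltW.
  lra.
rewrite -scaleNr dotZr -/g -/a -/h => D.
have E : (L0 + L1 * a) * (eta * h * r) ^+ 2 =
  eta * (eta * (L0 + L1 * a) * (h * r) ^+ 2) by ring.
rewrite E in D.
have F1 : eta * (eta * (L0 + L1 * a) * (h * r) ^+ 2) <=
   eta * (shrink c a * (2 / 9 * (a ^+ 2 + s ^+ 2))) by rewrite ler_pM2l.
have F2 : eta * (shrink c a * (a * (a - 2 * s))) <= eta * (h * dot g u).
  by rewrite ler_pM2l.
have F3 : eta * (shrink c a * (5 / 8 * a ^+ 2 + 2 / 9 * (a ^+ 2 + s ^+ 2))) <=
    eta * (shrink c a * (a * (a - 2 * s) + 9 * s ^+ 2)).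
  rewrite ler_pM2l// ler_wpM2l//.
  by have := sqr_ge0 (a - 8 * s); have := sqr_ge0 a; have := sqr_ge0 s; lra.
rewrite !mulrDr in F3 F1 *.
move: D F1 F2 F3; lra.
Qed.

End clipped_step.

(** * Independence *)

Section product_law.
Local Open Scope ereal_scope.
Context {dO d1 d2 : measure_display} {Omega : measurableType dO} {R : realType}.
Context {P : probability Omega R}.
Context {T1 : measurableType d1} {T2 : measurableType d2}.
Variables (Y : {mfun Omega >-> T1}) (Z : {mfun Omega >-> T2}).
Hypothesis YZ : forall A B, measurable A -> measurable B ->
  P (Y @^-1` A `&` Z @^-1` B) = P (Y @^-1` A) * P (Z @^-1` B).

Let mYZ : measurable_fun setT (fun w => (Y w, Z w)).
Proof. exact: measurable_fun_pair. Qed.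

Let YZfun : {mfun Omega >-> (T1 * T2)%type} := mfun_Sub (mem_set mYZ).

Let joint_lawE (S : set (T1 * T2)%type) : measurable S ->
  distribution P YZfun S = (distribution P Y \x distribution P Z) S.
Proof.
move=> mS; apply/esym.
apply: (product_measure_unique (m' := distribution P YZfun)) => //.
Qed.

Let ge0_integral_product_law (h : (T1 * T2)%type -> \bar R) :
  measurable_fun [set: (T1 * T2)%type] h -> (forall z, 0 <= h z) ->
  \int[P]_w h (Y w, Z w) =
  \int[distribution P Y]_y \int[distribution P Z]_z h (y, z).
Proof.
move=> mh h0; rewrite -(ge0_integral_distribution YZfun)//.
rewrite (eq_measure_integral (distribution P Y \x distribution P Z)); last first.
  by move=> A mA _; exact: joint_lawE.
by rewrite fubini_tonelli1.
Qed.

(** The law of the pair (Y, Z) is the product of the two laws, so that the two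
arguments can be integrated one after the other. Keeping the base space on the
right-hand side is what allows Y to be read as frozen. *)
Lemma ge0_integral_independent (h : (T1 * T2)%type -> \bar R) :
  measurable_fun [set: (T1 * T2)%type] h -> (forall z, 0 <= h z) ->
  \int[P]_w h (Y w, Z w) = \int[P]_w \int[P]_w' h (Y w, Z w').
Proof.
move=> mh h0.
rewrite ge0_integral_product_law// ge0_integral_distribution//; last 2 first.
- exact: measurable_fun_fubini_tonelli_F.
- by move=> y; apply: integral_ge0.
apply: eq_integral => w _ /=.
rewrite ge0_integral_distribution//.
by apply: measurableT_comp => //; exact: pair1_measurable.
Qed.

(** Fubini's theorem for phi(y) psi(z); its integrability for the product law
follows from that of phi(Y) psi(Z) by Tonelli's theorem. *)
Lemma integral_independent_mean0 (phi : T1 -> R) (psi : T2 -> R) :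
  measurable_fun setT phi -> measurable_fun setT psi ->
  P.-integrable setT (fun w => (phi (Y w) * psi (Z w))%:E) ->
  (distribution P Z).-integrable setT (EFin \o psi) ->
  \int[distribution P Z]_z (psi z)%:E = 0 ->
  \int[P]_w (phi (Y w) * psi (Z w))%:E = 0.
Proof.
move=> mphi mpsi ih ipsi psi0.
pose h (z : T1 * T2) := (phi z.1 * psi z.2)%:E.
have mh : measurable_fun [set: (T1 * T2)%type] h.
  apply/measurable_EFinP; apply: measurable_funM.
    exact: measurableT_comp mphi measurable_fst.
  exact: measurableT_comp mpsi measurable_snd.
have hprod : (distribution P Y \x distribution P Z).-integrable setT h.
  have mah : measurable_fun [set: (T1 * T2)%type] (abse \o h).
    exact: measurableT_comp.
  apply/integrable12ltyP => //.
  rewrite -(ge0_integral_product_law _ mah); last by move=> z; exact: abse_ge0.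
  by move/integrableP : ih => [].
transitivity (\int[distribution P YZfun]_z h z).
  by rewrite integral_distribution.
rewrite (eq_measure_integral (distribution P Y \x distribution P Z)); last first.
  by move=> A mA _; exact: joint_lawE.
rewrite -integral12_prod_meas1//; apply: integral0_eq => y _.
rewrite /fubini_F /h /=.
under eq_integral do rewrite EFinM.
by rewrite integralZl// psi0 mule0.
Qed.

End product_law.

Section independent_generators.
Local Open Scope ereal_scope.
Context {dO : measure_display} {Omega : measurableType dO} {R : realType}.
Variable P : probability Omega R.

(** On the pi-system G, the finite measures A |-> P (A `&` B) and
A |-> P A * P B coincide, hence they coincide on the sigma-algebra it
generates. *)
Lemma independent_sigma_left (G : set (set Omega)) (B : set Omega) :
  G `<=` measurable -> setI_closed G -> G setT -> measurable B ->
  (forall A, G A -> P (A `&` B) = P A * P B) ->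
  forall A, <<s G >> A -> P (A `&` B) = P A * P B.
Proof.
move=> mG GI GT mB GB.
have [r rE] : exists r : {nonneg R}, r%:num%:E = P B.
  by exists (NngNum (fine_ge0 (measure_ge0 P B))); rewrite fineK// fin_num_measure.
move=> A GA.
rewrite muleC -rE.
apply: (g_sigma_algebra_measure_unique G mG (fun=> setT) _ _
  (mrestr P mB) (mscale r P) GI _ _ A GA) => //.
- by rewrite bigcup_const//; exists 0%N.
- move=> C GC; transitivity (P C * P B); first exact: GB.
  by rewrite muleC -rE.
- by move=> k; rewrite /= /mrestr setTI ltey_eq fin_num_measure.
Qed.

(** The previous lemma, applied to each argument in turn. *)
Lemma independent_sigma (G1 G2 : set (set Omega)) :
  G1 `<=` measurable -> setI_closed G1 -> G1 setT ->
  G2 `<=` measurable -> setI_closed G2 -> G2 setT ->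
  (forall A B, G1 A -> G2 B -> P (A `&` B) = P A * P B) ->
  forall A B, <<s G1 >> A -> <<s G2 >> B -> P (A `&` B) = P A * P B.
Proof.
move=> mG1 GI1 GT1 mG2 GI2 GT2 G12 A B sA sB.
have mA : measurable A.
  by apply: smallest_sub sA => //; exact: sigma_algebra_measurable.
rewrite setIC muleC; apply: (independent_sigma_left G2) sB => // C GC.
rewrite setIC muleC; apply: (independent_sigma_left G1) sA => //.
- exact: mG2.
- by move=> D GD; exact: G12.
Qed.

End independent_generators.

Section cylinders.
Local Open Scope ereal_scope.
Context {dO dX : measure_display} {Omega : measurableType dO} {R : realType}.
Context {Xi : measurableType dX} {I : eqType}.
Implicit Types (J : set I) (X : I -> Omega -> Xi).

(** The events that constrain finitely many of the X j with j in J: a pi-system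
that generates the sigma-algebra of the subfamily indexed by J, and the one on
which mutual independence is stated. *)
Definition cylinder X J : set (set Omega) :=
  [set C | exists (s : seq I) (A : I -> set Xi),
    [/\ uniq s, {in s, forall j, J j}, (forall j, measurable (A j)) &
        C = \bigcap_(j in [set` s]) (X j @^-1` A j)]].

Lemma cylinder_setT X J : cylinder X J setT.
Proof.
exists [::], (fun=> setT); split=> //.
by apply/esym/seteqP; split=> // w _ j.
Qed.

Lemma cylinder_preimage X J j A : J j -> measurable A ->
  cylinder X J (X j @^-1` A).
Proof.
move=> Jj mA; exists [:: j], (fun=> A); split=> //.
- by move=> i; rewrite inE => /eqP ->.
- apply/seteqP; split=> [w Aw i|w]; first by rewrite /= inE => /eqP ->.
  by apply; rewrite /= inE.
Qed.

Lemma cylinder_setI X J : setI_closed (cylinder X J).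
Proof.
move=> _ _ [s [A [us sJ mA ->]]] [t [B [ut tJ mB ->]]].
exists (undup (s ++ t)), (fun j => (if j \in s then A j else setT) `&`
  (if j \in t then B j else setT)); split.
- exact: undup_uniq.
- move=> j; rewrite mem_undup mem_cat => /orP[]; [exact: sJ|exact: tJ].
- by move=> j; apply: measurableI; case: ifP.
- apply/seteqP; split=> w.
  + move=> [sw tw] j /=; rewrite mem_undup mem_cat => _.
    by split; case: ifPn => // jst; [exact: sw|exact: tw].
  + move=> stw; split=> j /= jst; have := stw j;
    by rewrite /= mem_undup mem_cat jst ?orbT => /(_ isT)[].
Qed.

Lemma cylinder_measurable X J : (forall j, measurable_fun setT (X j)) ->
  cylinder X J `<=` measurable.
Proof.
move=> mX _ [s [A [_ _ mA ->]]].
apply: fin_bigcap_measurable => // j _.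
by rewrite -[_ @^-1` _]setTI; exact: mX.
Qed.

(** Two constraints on disjoint sets of indices merge into a single one, on the
concatenation of their index lists. *)
Lemma cylinder_independent (P : probability Omega R) X J K :
  mutually_independent P X -> J `&` K = set0 ->
  forall A B, cylinder X J A -> cylinder X K B -> P (A `&` B) = P A * P B.
Proof.
move=> indep JK _ _ [s [A [us sJ mA ->]]] [t [B [ut tK mB ->]]].
have st j : j \in t -> j \in s = false.
  move=> jt; apply/negP => js.
  have : (J `&` K) j by split; [exact: sJ|exact: tK].
  by rewrite JK.
pose C j := if j \in s then A j else B j.
have CA j : j \in s -> C j = A j by rewrite /C => ->.
have CB j : j \in t -> C j = B j by move=> /st; rewrite /C => ->.
have mC j : measurable (C j) by rewrite /C; case: ifP.
have ust : uniq (s ++ t).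
  rewrite cat_uniq us ut andbT; apply/hasPn => j /st.
  by move=> ->.
have := indep (s ++ t) C ust mC; rewrite big_cat/=.
have -> : \bigcap_(j in [set` s ++ t]) X j @^-1` C j =
  \bigcap_(j in [set` s]) X j @^-1` A j `&` \bigcap_(j in [set` t]) X j @^-1` B j.
  apply/seteqP; split=> w.
    move=> Cw; split=> j /= jst; have := Cw j; rewrite /= mem_cat jst ?orbT.
      by rewrite CA//; exact.
    by rewrite CB//; exact.
  move=> [sw tw] j /=; rewrite mem_cat => /orP[js|jt].
    by rewrite CA//; exact: sw.
  by rewrite CB//; exact: tw.
move=> ->; rewrite !indep//; congr (_ * _); apply: eq_big_seq => j.
- by move=> js; rewrite CA.
- by move=> jt; rewrite CB.
Qed.

End cylinders.

(** * Borel functions on row vectors *)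

Section borel_row_vectors.
Context {R : realType} {d : nat}.

Definition rational_box (ab : {ffun 'I_d -> rat * rat}) : set 'rV[R]_d :=
  [set x | forall i, ratr (ab i).1 < x 0 i < ratr (ab i).2].

(** There are countably many rational boxes, so that this is a countable union. *)
Lemma open_bigcup_rational_box (U : set 'rV[R]_d) : open U ->
  U = \bigcup_(ab in [set ab | rational_box ab `<=` U]) rational_box ab.
Proof.
move=> oU; apply/seteqP; split=> [x Ux|x [ab abU abx]]; last exact: abU.
have : nbhs x U by rewrite nbhsE; exists U.
rewrite -nbhs_ballE => -[e /= e0 xeU].
have /fin_all_exists[ab abP] (i : 'I_d) : exists q : rat * rat,
    [/\ x 0 i - e < ratr q.1, ratr q.1 < x 0 i,
        x 0 i < ratr q.2 & ratr q.2 < x 0 i + e].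
  have /rat_in_itvoo[a] : x 0 i - e < x 0 i by rewrite ltrBlDr ltrDl.
  rewrite in_itv /= => /andP[a1 a2].
  have /rat_in_itvoo[b] : x 0 i < x 0 i + e by rewrite ltrDl.
  rewrite in_itv /= => /andP[b1 b2].
  by exists (a, b).
exists (finfun ab); last first.
  by move=> i; rewrite ffunE; have [_ -> -> _] := abP i.
move=> y yab; apply: xeU; split=> // i j.
rewrite ord1 /ball /= ltr_distlC.
have := yab j; rewrite ffunE; have [a1 a2 b1 b2] := abP j.
by move=> /andP[ya yb]; rewrite (lt_trans a1 ya) (lt_trans yb b2).
Qed.

(** Each open set is a countable union of boxes, and the preimage of a box is a
finite intersection of preimages of intervals under the coordinates. *)
Lemma measurable_borel_rV {dT} {T : measurableType dT} (h : T -> borel_rV R d) :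
  (forall i, measurable_fun setT (fun w => (h w : 'rV[R]_d) 0 i)) ->
  measurable_fun setT h.
Proof.
move=> mh; have mE : @measurable _ (borel_rV R d) = <<s (@open 'rV[R]_d) >> by [].
apply: (measurability _ mE).
move=> _ [U oU <-]; rewrite setTI (open_bigcup_rational_box U oU).
rewrite preimage_bigcup bigcup_mkcond.
apply: countable_bigcupT_measurable => [|ab]; first exact: countableP.
case: ifPn => // _.
have -> : h @^-1` rational_box ab = \bigcap_(i in [set: 'I_d])
    ((fun w => (h w : 'rV[R]_d) 0 i) @^-1` `](ratr (ab i).1), (ratr (ab i).2)[).
  apply/seteqP; split=> w hw i.
    by move=> _ /=; rewrite in_itv /=; exact: hw.
  by have /= := hw i Logic.I; rewrite in_itv.
apply: fin_bigcap_measurable => [|i _]; first exact: finite_finset.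
by rewrite -[_ @^-1` _]setTI; apply: mh => //; exact: measurable_itv.
Qed.

Lemma continuous_measurable_rV (f : 'rV[R]_d -> R) : continuous f ->
  measurable_fun [set: borel_rV R d] (f : borel_rV R d -> R).
Proof.
move=> /continuousP cf; apply: (measurability _ (RGenOpens.measurableE R)).
move=> _ [_ [a [b ->] <-]]; rewrite setTI.
by apply: sub_sigma_algebra; apply: cf; exact: interval_open.
Qed.

Lemma differentiable_measurable_rV (f : 'rV[R]_d -> R) :
  (forall x, differentiable f x) ->
  measurable_fun [set: borel_rV R d] (f : borel_rV R d -> R).
Proof.
move=> df; apply: continuous_measurable_rV => x.
exact: differentiable_continuous.
Qed.

Lemma measurable_coord (i : 'I_d) :
  measurable_fun [set: borel_rV R d] (fun x => (x : 'rV[R]_d) 0 i).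
Proof. by apply: continuous_measurable_rV; exact: coord_continuous. Qed.

Lemma measurable_l2norm {dT} {T : measurableType dT} (h : T -> 'rV[R]_d) :
  (forall i, measurable_fun setT (fun w => h w 0 i)) ->
  measurable_fun setT (fun w => l2norm (h w)).
Proof.
move=> mh; apply: (@measurableT_comp _ _ _ _ _ _ (@Num.sqrt R)).
  by apply: continuous_measurable_fun; exact: sqrt_continuous.
by apply: measurable_sum => i; exact: measurable_funX.
Qed.

Lemma continuous_l2norm : continuous (@l2norm R d).
Proof.
have csum : continuous (fun x : 'rV[R]_d => \sum_(i < d) x 0 i ^+ 2).
  apply: continuous_big => [|i _ x]; first exact: add_continuous.
  apply: (@continuous_comp _ _ _ (fun x : 'rV[R]_d => x 0 i) (fun r => r ^+ 2)).
    exact: coord_continuous.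
  exact: exprn_continuous.
move=> x; apply: (continuous_comp (csum x)); exact: sqrt_continuous.
Qed.

(** (L0, L1)-smoothness makes the gradient locally Lipschitz, hence
continuous. *)
Lemma measurable_grad_coord (f : 'rV[R]_d -> R) (L0 L1 : R) i :
  0 <= L0 -> 0 <= L1 -> L0L1_smooth L0 L1 f ->
  measurable_fun [set: borel_rV R d] (fun x => grad f (x : 'rV[R]_d) 0 i).
Proof.
move=> L00 L10 smooth; apply: continuous_measurable_rV => x.
apply/(@cvgrPdist_lt _ _ _ (nbhs x) (nbhs_filter x)) => e e0.
pose K := L0 + L1 * l2norm (grad f x).
have K0 : 0 <= K by rewrite addr_ge0// mulr_ge0// l2norm_ge0.
(* adding 1 to the denominators avoids a case distinction on L1 = 0 and K = 0 *)
pose del := Num.min (1 + L1)^-1 (e / (1 + K)).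
have del0 : 0 < del.
  by rewrite lt_min invr_gt0 divr_gt0// ltr_pwDl.
have : {for x, continuous (fun y : 'rV[R]_d => l2norm (y - x))}.
  apply: (@continuous_comp _ _ _ (fun y : 'rV[R]_d => y - x) (@l2norm R d)).
    by apply: (@continuousB _ _ _ id (cst x) x); [by move=> A|exact: cst_continuous].
  exact: continuous_l2norm.
rewrite /prop_for /continuous_at subrr l2norm0 => cx.
move/(@cvgrPdist_lt _ _ _ (nbhs x) (nbhs_filter x)) : cx => /(_ _ del0).
apply: filterS => y.
rewrite sub0r normrN ger0_norm ?l2norm_ge0// lt_min => /andP[y1 y2].
have coord : `|grad f x 0 i - grad f y 0 i| <= l2norm (grad f y - grad f x).
  rewrite distrC -sqrtr_sqr ler_sqrt ?sumr_ge0//; last by move=> ? _; exact: sqr_ge0.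
  rewrite (bigD1 i)//= !mxE lerDl sumr_ge0// => ? _; exact: sqr_ge0.
apply: le_lt_trans coord _.
have : l2norm (grad f y - grad f x) <= K * l2norm (y - x).
  apply: smooth; rewrite lee_inve//.
  rewrite -[_^-1]mul1r ltr_pdivlMr ?ltr_pwDl// in y1.
  by have := l2norm_ge0 (y - x); lra.
move/le_lt_trans; apply.
apply: (@le_lt_trans _ _ (K * (e / (1 + K)))).
  by rewrite ler_wpM2l// ltW.
rewrite mulrCA gtr_pMr// ltr_pdivrMr ?ltr_pwDl// mul1r.
by rewrite ltrDr.
Qed.

Lemma measurable_shrink (c : R) : 0 < c -> measurable_fun setT (shrink c).
Proof.
move=> c0; apply: continuous_measurable_fun => r.
apply: cvgM; first exact: cvg_cst.
apply: cvgV; first by rewrite gt_eqF// lt_max c0.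
by apply: (@continuous_max R _ (cst c) id r); [exact: cvg_cst|exact: cvg_id].
Qed.

End borel_row_vectors.

(** * Variance of a batch gradient *)

Section second_moments.
Local Open Scope ereal_scope.
Context {dT : measure_display} {T : measurableType dT} {R : realType}.
Variable P : probability T R.

Lemma probability_integral_cst (r : R) : \int[P]_w r%:E = r%:E.
Proof. by rewrite integral_cst//= probability_setT mule1. Qed.

Lemma integrable_mul (U V : T -> R) :
  measurable_fun setT U -> measurable_fun setT V ->
  P.-integrable setT (fun w => (U w ^+ 2)%:E) ->
  P.-integrable setT (fun w => (V w ^+ 2)%:E) ->
  P.-integrable setT (fun w => (U w * V w)%:E).
Proof.
move=> mU mV iU iV.
apply: (le_integrable measurableT _ _ (integrableD measurableT iU iV)).
  by apply/measurable_EFinP; exact: measurable_funM.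
move=> w _ /=; rewrite lee_fin.
rewrite [leRHS]ger0_norm ?addr_ge0 ?sqr_ge0// ler_norml.
have := sqr_ge0 (U w - V w); have := sqr_ge0 (U w + V w).
have := sqr_ge0 (U w); have := sqr_ge0 (V w); lra.
Qed.

(** Pythagoras in L^2. *)
Lemma integral_sqr_sum_orthogonal n (W : 'I_n -> T -> R) :
  (forall i, measurable_fun setT (W i)) ->
  (forall i, P.-integrable setT (fun w => (W i w ^+ 2)%:E)) ->
  (forall i j, i != j -> \int[P]_w (W i w * W j w)%:E = 0) ->
  \int[P]_w ((\sum_(i < n) W i w) ^+ 2)%:E =
  \sum_(i < n) \int[P]_w (W i w ^+ 2)%:E.
Proof.
move=> mW iW W0.
have iWW i j : P.-integrable setT (fun w => (W i w * W j w)%:E).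
  exact: integrable_mul.
transitivity (\int[P]_w (\sum_(i < n) \sum_(j < n) (W i w * W j w)%:E)).
  apply: eq_integral => w _; rewrite expr2 mulr_suml -sumEFin.
  by apply: eq_bigr => i _; rewrite mulr_sumr sumEFin.
rewrite integral_sum//; last by move=> i; exact: integrable_sum.
apply: eq_bigr => i _; rewrite integral_sum// (bigD1 i)//=.
rewrite [X in _ + X]big1 ?adde0; last by move=> j ji; rewrite W0// eq_sym.
by apply: eq_integral => w _; rewrite expr2.
Qed.

Lemma integral_sqr_centered (U : T -> R) (m : R) :
  P.-integrable setT (EFin \o U) ->
  P.-integrable setT (fun w => (U w ^+ 2)%:E) ->
  \int[P]_w (U w)%:E = m%:E ->
  P.-integrable setT (fun w => ((U w - m) ^+ 2)%:E) /\
  \int[P]_w ((U w - m) ^+ 2)%:E = \int[P]_w (U w ^+ 2)%:E - (m ^+ 2)%:E.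
Proof.
move=> iU iU2 Um.
have E : (fun w => ((U w - m) ^+ 2)%:E) =
    ((fun w => (U w ^+ 2)%:E) \+ (fun w => (- 2 * m)%:E * (U w)%:E)) \+
    (EFin \o cst (m ^+ 2)%R).
  by apply/funext => w /=; rewrite -EFinM -!EFinD; congr EFin; ring.
have iZ : P.-integrable setT (fun w => (- 2 * m)%:E * (U w)%:E).
  exact: integrableZl.
have ic := finite_measure_integrable_cst P (m ^+ 2) (@measurableT _ T).
have iUZ := integrableD measurableT iU2 iZ.
rewrite E; split; first exact: integrableD.
rewrite integralD// integralD// integralZl// Um.
have -> : \int[P]_x (EFin \o cst (m ^+ 2)%R) x = (m ^+ 2)%:E.
  exact: probability_integral_cst.
rewrite -addeA -EFinM -EFinD -EFinN; congr (_ + _%:E); ring.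
Qed.

End second_moments.

Section sampling_noise.
Local Open Scope ereal_scope.
Context {dX : measure_display} {Xi : measurableType dX} {R : realType} {d : nat}.
Variable D : probability Xi R.

(** Coordinatewise, the second moment is the variance plus the squared mean;
summing over coordinates turns the growth factor rho into rho - 1. *)
Lemma sample_variance (H : Xi -> 'rV[R]_d) (mu : 'rV[R]_d) (rho : R) :
  (forall l, D.-integrable setT (fun s => (H s 0 l)%:E)) ->
  (forall l, \int[D]_s (H s 0 l)%:E = (mu 0 l)%:E) ->
  \int[D]_s (l2norm (H s) ^+ 2)%:E <= (rho * l2norm mu ^+ 2)%:E ->
  (forall l, D.-integrable setT (fun s => ((H s 0 l - mu 0 l) ^+ 2)%:E)) /\
  \sum_(l < d) \int[D]_s ((H s 0 l - mu 0 l) ^+ 2)%:E <=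
    ((rho - 1) * l2norm mu ^+ 2)%:E.
Proof.
move=> iH Hmu Hrho.
have mH l : measurable_fun setT (fun s => H s 0%R l).
  by have /measurable_int/measurable_EFinP := iH l.
have mH2 l : measurable_fun setT (fun s => (H s 0 l ^+ 2)%:E).
  by apply/measurable_EFinP; exact: measurable_funX.
have H20 l s : 0 <= (H s 0 l ^+ 2)%:E by rewrite lee_fin sqr_ge0.
have sumE : \int[D]_s (l2norm (H s) ^+ 2)%:E =
    \sum_(l < d) \int[D]_s (H s 0 l ^+ 2)%:E.
  rewrite -ge0_integral_sum//.
  by apply: eq_integral => s _; rewrite l2norm_sqr sumEFin.
rewrite sumE in Hrho.
have iH2 l : D.-integrable setT (fun s => (H s 0 l ^+ 2)%:E).
  apply/integrableP; split=> //.
  under eq_integral do rewrite gee0_abs//.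
  apply: le_lt_trans (ltry (rho * l2norm mu ^+ 2)%R).
  apply: le_trans Hrho; rewrite (bigD1 l)//= leeDl// sume_ge0// => ? _.
  by apply: integral_ge0 => s _.
have cent l := integral_sqr_centered D _ _ (iH l) (iH2 l) (Hmu l).
split; first by move=> l; have [] := cent l.
have fin l : \int[D]_s (H s 0 l ^+ 2)%:E =
    (fine (\int[D]_s (H s 0 l ^+ 2)%:E))%:E.
  by rewrite fineK//; exact: integrable_fin_num.
under eq_bigr do rewrite (cent _).2 fin -EFinB.
rewrite (eq_bigr _ (fun l _ => fin l)) in Hrho.
rewrite sumEFin lee_fin in Hrho.
rewrite sumEFin lee_fin sumrB -l2norm_sqr mulrBl mul1r lerB//.
Qed.

Context {dO : measure_display} {Omega : measurableType dO}.
Variable P : probability Omega R.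

(** The centered samples are pairwise orthogonal, so the variance of their sum is
B times that of one of them, and averaging divides it by B^2. *)
Lemma batch_variance B (X : 'I_B -> {RV P >-> Xi})
    (H : Xi -> 'rV[R]_d) (mu : 'rV[R]_d) (rho : R) :
  (0 < B)%N ->
  (forall i, has_law (X i) D) ->
  (forall i j, i != j -> forall A A', measurable A -> measurable A' ->
    P (X i @^-1` A `&` X j @^-1` A') = P (X i @^-1` A) * P (X j @^-1` A')) ->
  (forall l, D.-integrable setT (fun s => (H s 0 l)%:E)) ->
  (forall l, \int[D]_s (H s 0 l)%:E = (mu 0 l)%:E) ->
  \int[D]_s (l2norm (H s) ^+ 2)%:E <= (rho * l2norm mu ^+ 2)%:E ->
  \int[P]_w (l2norm (B%:R^-1 *: \sum_(i < B) H (X i w) - mu) ^+ 2)%:E <=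
    ((rho - 1) * l2norm mu ^+ 2 / B%:R)%:E.
Proof.
move=> B0 law indep iH Hmu Hrho.
have [iV sumV] := sample_variance H mu rho iH Hmu Hrho.
have mH l : measurable_fun setT (fun s => H s 0%R l).
  by have /measurable_int/measurable_EFinP := iH l.
pose V (l : 'I_d) s := (H s 0 l - mu 0 l)%R.
have mV l : measurable_fun setT (V l) by exact: measurable_funB.
have lawE i (h : Xi -> \bar R) :
    \int[distribution P (X i)]_s h s = \int[D]_s h s.
  by apply: eq_measure_integral => A mA _; exact: law.
have V1 i l : (distribution P (X i)).-integrable setT (EFin \o V l) /\
    \int[distribution P (X i)]_s (V l s)%:E = 0.
  have icst := finite_measure_integrable_cst D (mu 0%R l) (@measurableT _ Xi).
  have iVD : D.-integrable setT (EFin \o V l).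
    by apply: eq_integrable (integrableB measurableT (iH l) icst).
  split.
    move: iVD => /integrableP[mVl Vfin]; apply/integrableP; split=> //.
    by rewrite lawE.
  rewrite lawE//.
  under eq_integral do rewrite EFinB.
  rewrite (integralB_EFin measurableT (iH l) icst) Hmu.
  by rewrite probability_integral_cst subee.
have iV2 i l : P.-integrable setT (fun w => (V l (X i w) ^+ 2)%:E).
  apply/integrableP; split.
    by apply/measurable_EFinP/measurable_funX; exact: measurableT_comp.
  rewrite -(ge0_integral_distribution (X i) (f := fun s => `|(V l s ^+ 2)%:E|)) //.
    rewrite lawE//.
    by have /integrableP[] := iV l.
  apply: measurableT_comp => //.
  by apply/measurable_EFinP/measurable_funX.
have V2E i l : \int[P]_w (V l (X i w) ^+ 2)%:E = \int[D]_s (V l s ^+ 2)%:E.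
  have mV2 : measurable_fun setT (fun s => (V l s ^+ 2)%:E).
    by apply/measurable_EFinP/measurable_funX.
  have V20 s : 0 <= (V l s ^+ 2)%:E by rewrite lee_fin sqr_ge0.
  by rewrite -(ge0_integral_distribution (X i) mV2 V20) lawE.
have ortho l i j : i != j -> \int[P]_w (V l (X i w) * V l (X j w))%:E = 0.
  move=> ij; have [iXj Xj0] := V1 j l.
  apply: (integral_independent_mean0 (X i) (X j)) => //.
    exact: indep.
  by apply: integrable_mul => //; exact: measurableT_comp.
have Bn0 : (B%:R != 0 :> R)%R by rewrite pnatr_eq0 -lt0n.
have batchE w : (l2norm (B%:R^-1 *: \sum_(i < B) H (X i w) - mu) ^+ 2 =
    B%:R^-1 ^+ 2 * \sum_(l < d) (\sum_(i < B) V l (X i w)) ^+ 2)%R.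
  rewrite l2norm_sqr mulr_sumr; apply: eq_bigr => l _.
  rewrite -exprMn !mxE summxE sumrB sumr_const card_ord; congr (_ ^+ 2)%R.
  by rewrite mulrBr -[X in (_ - _ * X)%R]mulr_natl mulKf.
have mS l : measurable_fun setT (fun w => (\sum_(i < B) V l (X i w)) ^+ 2)%R.
  by apply: measurable_funX; apply: measurable_sum => i; exact: measurableT_comp.
under eq_integral do rewrite batchE EFinM -sumEFin.
have mSE l : measurable_fun setT (fun w => ((\sum_(i < B) V l (X i w)) ^+ 2)%:E).
  exact/measurable_EFinP.
have S0 l w : 0 <= ((\sum_(i < B) V l (X i w)) ^+ 2)%:E by rewrite lee_fin sqr_ge0.
rewrite ge0_integralZl_EFin//; last 2 first.
- by move=> w _; exact: sume_ge0.
- by apply: emeasurable_sum.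
rewrite ge0_integral_sum//.
have -> : \sum_(l < d) \int[P]_w ((\sum_(i < B) V l (X i w)) ^+ 2)%:E =
    B%:R%:E * \sum_(l < d) \int[D]_s (V l s ^+ 2)%:E.
  rewrite ge0_sume_distrr; last first.
    by move=> l _; apply: integral_ge0 => s _; rewrite lee_fin sqr_ge0.
  apply: eq_bigr => l _.
  rewrite (integral_sqr_sum_orthogonal P B (fun i w => V l (X i w)))//; last 2 first.
  - by move=> i; exact: measurableT_comp.
  - by move=> i j; exact: ortho.
  under eq_bigr do rewrite V2E.
  by rewrite sumr_const card_ord mule_natl.
rewrite muleA -EFinM.
have -> : (B%:R^-1 ^+ 2 * B%:R = B%:R^-1 :> R)%R by field.
rewrite [leRHS](_ : _ = B%:R^-1%:E * ((rho - 1) * l2norm mu ^+ 2)%:E); last first.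
  by rewrite -EFinM mulrC.
by rewrite lee_wpmul2l// lee_fin invr_ge0.
Qed.

End sampling_noise.

(** * One iteration *)

Definition clip_step {R : realType} {d : nat} {Xi : Type}
    (G : 'rV[R]_d -> Xi -> 'rV[R]_d) (eta c : R) {B : nat} (x : 'rV[R]_d)
    (s : 'I_B -> Xi) : 'rV[R]_d :=
  x - (eta * clip_factor c (batch_grad G x s)) *: batch_grad G x s.

(** Measurability is proved with the point and the samples given by arbitrary
measurable maps Y and Z, so as to cover a frozen point, an iterate, and the
coordinates of a product space alike. *)
Section clip_step_measurable.
Context {R : realType} {d B : nat} {dX : measure_display}.
Context {Xi : measurableType dX}.
Variables (G : 'rV[R]_d -> Xi -> 'rV[R]_d) (eta c : R).
Hypotheses (mG : jointly_measurable G) (c0 : 0 < c).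
Context {dT : measure_display} {T : measurableType dT}.
Variables (Y : T -> borel_rV R d) (Z : 'I_B -> T -> Xi).
Hypotheses (mY : measurable_fun setT Y) (mZ : forall i, measurable_fun setT (Z i)).

Lemma measurable_batch_grad l :
  measurable_fun setT (fun t => batch_grad G (Y t) (Z^~ t) 0 l).
Proof.
have -> : (fun t => batch_grad G (Y t) (Z^~ t) 0 l) =
    (fun t => B%:R^-1 * \sum_(i < B) G (Y t) (Z i t) 0 l).
  by apply/funext => t; rewrite !mxE summxE.
apply: measurable_funM => //; apply: measurable_sum => i.
exact: (measurableT_comp (mG l) (measurable_fun_pair mY (mZ i))).
Qed.

Lemma measurable_clip_step :
  measurable_fun setT (fun t => clip_step G eta c (Y t) (Z^~ t) : borel_rV R d).
Proof.
apply: measurable_borel_rV => l.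
have -> : (fun t => (clip_step G eta c (Y t) (Z^~ t) : 'rV[R]_d) 0 l) =
    (fun t => (Y t : 'rV[R]_d) 0 l -
      eta * shrink c (l2norm (batch_grad G (Y t) (Z^~ t))) *
      batch_grad G (Y t) (Z^~ t) 0 l).
  by apply/funext => t; rewrite /clip_step clip_factorE// !mxE.
apply: measurable_funB; first exact: measurableT_comp (measurable_coord l) mY.
apply: measurable_funM; last exact: measurable_batch_grad.
apply: measurable_funM => //.
apply: measurableT_comp; first exact: measurable_shrink.
by apply: measurable_l2norm => i; exact: measurable_batch_grad.
Qed.

End clip_step_measurable.

Section frozen_step.
Local Open Scope ereal_scope.
Context {R : realType} {d B : nat} {dX dO : measure_display}.
Context {Xi : measurableType dX} {Omega : measurableType dO}.
Variables (D : probability Xi R) (P : probability Omega R).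
Variables (f : 'rV[R]_d -> R) (G : 'rV[R]_d -> Xi -> 'rV[R]_d).
Variables (X : 'I_B -> {RV P >-> Xi}) (fstar L0 L1 rho eta c : R).
Hypotheses (f_diff : forall x, differentiable f x) (f_ge : forall x, (fstar <= f x)%R).
Hypotheses (L0_ge0 : (0 <= L0)%R) (L1_ge0 : (0 <= L1)%R).
Hypothesis f_smooth : L0L1_smooth L0 L1 f.
Hypotheses (mG : jointly_measurable G) (G_unbiased : unbiased D f G).
Hypothesis G_growth : strong_growth D rho f G.
Hypotheses (c_gt0 : (0 < c)%R) (eta_gt0 : (0 < eta)%R).
Hypothesis eta_le : (eta * (9 * (L0 + L1 * c)) <= 1)%R.
Hypotheses (B_gt0 : (0 < B)%N) (B_ge : (72 * (rho - 1) <= B%:R)%R).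
Hypothesis X_law : forall i, has_law (X i) D.
Hypothesis X_indep : forall i j, i != j ->
  forall A A', measurable A -> measurable A' ->
  P (X i @^-1` A `&` X j @^-1` A') = P (X i @^-1` A) * P (X j @^-1` A').

(** Integrate the pointwise inequality. The mean of s^2 is at most a^2 / 72 and its
coefficient is 9 times eta q, which takes eta q a^2 / 8 from the decrease
5/8 eta q a^2. *)
Lemma expected_descent (x : 'rV[R]_d) :
  \int[P]_w (f (clip_step G eta c x (X^~ w)) - fstar)%:E +
    (eta / 2 * (shrink c (l2norm (grad f x)) * l2norm (grad f x) ^+ 2))%:E <=
  (f x - fstar)%:E.
Proof.
set a := l2norm (grad f x); set q := shrink c a.
have q0 : (0 <= q)%R by exact: shrink_ge0.
pose s w := l2norm (batch_grad G x (X^~ w) - grad f x).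
have mx : measurable_fun setT (cst x : Omega -> borel_rV R d) by exact: measurable_cst.
have mbatch l : measurable_fun setT (fun w => batch_grad G x (X^~ w) 0%R l).
  by apply: (measurable_batch_grad G mG (cst x) (fun i => X i)).
have ms : measurable_fun setT (fun w => (s w ^+ 2)%R).
  apply: measurable_funX; apply: measurable_l2norm => l.
  have -> : (fun w => ((batch_grad G x (X^~ w) - grad f x) 0 l)%R) =
      (fun w => batch_grad G x (X^~ w) 0 l - grad f x 0 l)%R.
    by apply/funext => w; rewrite !mxE.
  exact: measurable_funB.
have mnext : measurable_fun setT
    (fun w => f (clip_step G eta c x (X^~ w)) - fstar)%R.
  apply: measurable_funB => //.
  by apply: (measurableT_comp (differentiable_measurable_rV f f_diff)
    (measurable_clip_step G eta c mG c_gt0 (cst x) (fun i => X i) mx _)).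
have var : \int[P]_w (s w ^+ 2)%:E <= (a ^+ 2 / 72)%:E.
  apply: (@le_trans _ _ ((rho - 1) * a ^+ 2 / B%:R)%:E).
    apply: (batch_variance D P B X (G x) (grad f x) rho) => //.
    - by move=> l; have [] := G_unbiased x l.
    - by move=> l; have [_] := G_unbiased x l; rewrite unlock.
    - by have := G_growth x; rewrite unlock.
  rewrite lee_fin ler_pdivrMr ?ltr0n// mulrAC ler_pdivlMr//.
  by rewrite mulrC mulrA mulrC ler_wpM2l// sqr_ge0.
have eta0 := ltW eta_gt0.
pose K1 := (eta * (q * (5 / 8 * a ^+ 2)))%R.
pose K2 := (eta * (q * 9))%R.
have K10 : (0 <= K1)%R.
  by rewrite mulr_ge0// mulr_ge0// mulr_ge0// sqr_ge0.
have K20 : (0 <= K2)%R by rewrite mulr_ge0// mulr_ge0.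
have step w : (f (clip_step G eta c x (X^~ w)) - fstar + K1 <=
    f x - fstar + K2 * s w ^+ 2)%R.
  have := clipped_descent f L0 L1 eta c x (batch_grad G x (X^~ w)) f_diff
    L0_ge0 L1_ge0 f_smooth c_gt0 eta_gt0 eta_le.
  rewrite -/a -/q -/(s w) -/K1 -/(clip_step _ _ _ _ _) => h.
  rewrite /K2; lra.
have intle : \int[P]_w (f (clip_step G eta c x (X^~ w)) - fstar + K1)%:E <=
    \int[P]_w (f x - fstar + K2 * s w ^+ 2)%:E.
  apply: ge0_le_integral => //.
  - by move=> w _; rewrite lee_fin addr_ge0// subr_ge0.
  - by apply/measurable_EFinP; exact: measurable_funD.
  - apply/measurable_EFinP; apply: measurable_funD => //.
    exact: measurable_funM.
  - by move=> w _; rewrite lee_fin.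
have lhsE : \int[P]_w (f (clip_step G eta c x (X^~ w)) - fstar + K1)%:E =
    \int[P]_w (f (clip_step G eta c x (X^~ w)) - fstar)%:E + K1%:E.
  under eq_integral do rewrite EFinD.
  rewrite ge0_integralD//; first by rewrite probability_integral_cst.
  - by move=> w _; rewrite lee_fin subr_ge0.
  - exact/measurable_EFinP.
have rhsE : \int[P]_w (f x - fstar + K2 * s w ^+ 2)%:E =
    (f x - fstar)%:E + K2%:E * \int[P]_w (s w ^+ 2)%:E.
  under eq_integral do rewrite EFinD EFinM.
  rewrite ge0_integralD//; last 3 first.
  - by move=> w _; rewrite lee_fin subr_ge0.
  - by move=> w _; rewrite mule_ge0// lee_fin sqr_ge0.
  - by apply: measurable_funeM; exact/measurable_EFinP.
  rewrite probability_integral_cst ge0_integralZl_EFin//.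
  - by move=> w _; rewrite lee_fin sqr_ge0.
  - exact/measurable_EFinP.
rewrite lhsE rhsE in intle.
have K20E : 0 <= K2%:E by rewrite lee_fin.
have := le_trans intle (leeD2l _ (lee_wpmul2l K20E var)).
(* the inequality itself rules out that the expected gap is infinite *)
case: (\int[P]_w _) => [r| |].
- rewrite -EFinM -!EFinD !lee_fin /K1 /K2 => h.
  have -> : (eta / 2 * (q * a ^+ 2) =
    eta * (q * (5 / 8 * a ^+ 2)) - eta * (q * 9) * (a ^+ 2 / 72))%R by field.
  lra.
- by rewrite -EFinM -EFinD addye.
- by move=> _; rewrite addNye leNye.
Qed.

End frozen_step.

(** * Iterates and their independence from the next batch *)

Section adapted_iterates.
Context {R : realType} {d B : nat} {dX dO : measure_display}.
Context {Xi : measurableType dX} {Omega : measurableType dO}.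
Variable P : probability Omega R.
Variables (G : 'rV[R]_d -> Xi -> 'rV[R]_d) (xi : nat -> 'I_B -> {RV P >-> Xi}).
Variables (eta c : R) (x0 : 'rV[R]_d).
Hypotheses (mG : jointly_measurable G) (c0 : 0 < c).

Let sample (ki : (nat * 'I_B)%type) : Omega -> Xi := xi ki.1 ki.2.
Let past k : set (nat * 'I_B) := [set ki | (ki.1 < k)%N].
Let present k : set (nat * 'I_B) := [set ki | ki.1 = k].

Definition iterate k (w : Omega) : 'rV[R]_d :=
  clipSGD G eta c x0 (fun j i => xi j i w) k.

Lemma measurable_sample J ki : J ki ->
  @measurable_fun _ _ (g_sigma_algebraType (cylinder sample J)) Xi setT
    (sample ki).
Proof.
move=> Jki _ A mA; rewrite setTI; apply: sub_sigma_algebra.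
exact: cylinder_preimage.
Qed.

(** The sigma-algebra is that of the first K batches with K fixed, which spares
the induction any comparison of sigma-algebras. *)
Lemma iterate_adapted K k : (k <= K)%N ->
  @measurable_fun _ _ (g_sigma_algebraType (cylinder sample (past K)))
    (borel_rV R d) setT (iterate k).
Proof.
elim: k => [|k IHk] kK; first exact: measurable_cst.
have mk := IHk (ltnW kK).
have mZ i := measurable_sample (past K) (k, i) kK.
exact: (measurable_clip_step (T := g_sigma_algebraType (cylinder sample (past K)))
  G eta c mG c0 _ (fun i => sample (k, i)) mk mZ).
Qed.

Hypothesis xi_indep : mutually_independent P sample.

(** A sub-sigma-algebra is represented by the identity map from the sample space
to the same set with fewer measurable sets. *)
Lemma measurable_id_cylinder J :
  @measurable_fun _ _ Omega (g_sigma_algebraType (cylinder sample J)) setT idfun.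
Proof.
move=> _ A mA; rewrite setTI.
apply: smallest_sub mA; first exact: sigma_algebra_measurable.
by apply: cylinder_measurable => ki; exact: measurable_funPT.
Qed.

Lemma measurable_iterate k :
  @measurable_fun _ _ Omega (borel_rV R d) setT (iterate k).
Proof.
exact: (measurableT_comp (iterate_adapted k k (leqnn k))
  (measurable_id_cylinder (past k))).
Qed.

Let state k : {mfun Omega >-> borel_rV R d} :=
  mfun_Sub (mem_set (measurable_iterate k)).
Let batch_info k : {mfun Omega >-> g_sigma_algebraType (cylinder sample (present k))} :=
  mfun_Sub (mem_set (measurable_id_cylinder (present k))).

(** Two disjoint sets of samples generate independent sigma-algebras; the first
one contains the events that depend on the k-th iterate only. *)
Lemma iterate_independent k (A : set (borel_rV R d))
    (C : set (g_sigma_algebraType (cylinder sample (present k)))) :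
  measurable A -> measurable C ->
  (P (state k @^-1` A `&` batch_info k @^-1` C) =
   P (state k @^-1` A) * P (batch_info k @^-1` C))%E.
Proof.
move=> mA mC.
have mX ki : measurable_fun setT (sample ki) by exact: measurable_funPT.
apply: (independent_sigma P (cylinder sample (past k))
  (cylinder sample (present k))) => //.
- exact: cylinder_measurable.
- exact: cylinder_setI.
- exact: cylinder_setT.
- exact: cylinder_measurable.
- exact: cylinder_setI.
- exact: cylinder_setT.
- apply: cylinder_independent => //.
  by apply/seteqP; split=> // -[j i] [jk kj]; move: jk; rewrite /past /= (kj : j = k) ltnn.
- by have := iterate_adapted k k (leqnn k) measurableT _ mA; rewrite setTI.
Qed.

(** The k-th batch is the identity map to the sigma-algebra of its samples, and
the next iterate is a function of the k-th iterate and of that map. *)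
Lemma expectation_next k (g : borel_rV R d -> \bar R) :
  measurable_fun setT g -> (forall y, 0 <= g y)%E ->
  (\int[P]_w g (iterate k.+1 w) =
   \int[P]_w \int[P]_w' g (clip_step G eta c (iterate k w) ((xi k)^~ w')))%E.
Proof.
move=> mg g0.
pose Opres := g_sigma_algebraType (cylinder sample (present k)).
pose h (z : borel_rV R d * Opres) :=
  g (clip_step G eta c z.1 (fun i => sample (k, i) z.2)).
have mh : measurable_fun [set: (borel_rV R d * Opres)%type] h.
  apply: (measurableT_comp mg).
  apply: (measurable_clip_step (T := (borel_rV R d * Opres)%type)
    G eta c mG c0 fst (fun i z => sample (k, i) z.2)) => // i.
  exact: (measurableT_comp (measurable_sample (present k) (k, i) erefl)).
have h0 z : (0 <= h z)%E by exact: g0.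
exact: (ge0_integral_independent (state k) (batch_info k)
  (iterate_independent k) h mh h0).
Qed.

End adapted_iterates.

(** * Convergence rate *)

Lemma le_shrink_sqr {R : realType} (c a t : R) : 0 < c -> 0 <= a -> 0 < t ->
  a <= ((2 * t)^-1 + c^-1) * (shrink c a * a ^+ 2) + t / 2.
Proof.
move=> c0 a0 t0; have [ac|ca] := leP a c.
  rewrite (shrink_le c a)// mul1r mulrDl.
  have : 0 <= c^-1 * a ^+ 2 by rewrite mulr_ge0 ?sqr_ge0// invr_ge0 ltW.
  have : 0 <= (2 * t)^-1 * (a - t) ^+ 2.
    by rewrite mulr_ge0 ?sqr_ge0// invr_ge0 mulr_ge0// ltW.
  rewrite (_ : (2 * t)^-1 * (a - t) ^+ 2 =
    (2 * t)^-1 * a ^+ 2 + t / 2 - a); last by field; lra.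
  lra.
rewrite (shrink_ge c a (ltW ca)).
have agt : 0 < a by lra.
rewrite (_ : _ + t / 2 = a + (c * a / (2 * t) + t / 2)); last first.
  by field; rewrite !gt_eqF.
rewrite lerDl addr_ge0// ?divr_ge0// ?mulr_ge0//; exact: ltW.
Qed.

Lemma telescope_le {R : realType} (u v : nat -> \bar R) :
  (forall k, u k.+1 + v k <= u k)%E ->
  (forall n, u n + \sum_(k < n) v k <= u 0%N)%E.
Proof.
move=> uv; elim=> [|n IHn]; first by rewrite big_ord0 adde0.
rewrite big_ord_recr/= [(_ + v n)%E]addeC addeA; apply: le_trans IHn.
by rewrite leeD2r.
Qed.

Theorem theorem4p1 (R : realType) (d : nat)
  (dX dO : measure_display) (Xi : measurableType dX) (D : probability Xi R)
  (f : 'rV[R]_d -> R) (F : 'rV[R]_d -> Xi -> R)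
  (G : 'rV[R]_d -> Xi -> 'rV[R]_d)
  (fstar L0 L1 rho : R)
  (Omega : measurableType dO) (P : probability Omega R)
  (B : nat) (xi : nat -> 'I_B -> {RV P >-> Xi})
  (x0 : 'rV[R]_d) (eta c : R) (N : nat)
  (f_expected : is_expected_loss D F f)
  (f_diff : forall x, differentiable f x)
  (f_min : is_minimum f fstar)
  (L0_ge0 : 0 <= L0) (L1_ge0 : 0 <= L1)
  (f_smooth : L0L1_smooth L0 L1 f)
  (G_grad : is_stochastic_gradient D F G)
  (G_unbiased : unbiased D f G)
  (rho_ge1 : 1 <= rho)
  (G_growth : strong_growth D rho f G)
  (xi_iid : iid_samples D xi)
  (c_gt0 : 0 < c)
  (eta_gt0 : 0 < eta)
  (eta_le : (eta%:E <= ((9 * (L0 + L1 * c))%:E)^-1)%E)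
  (B_ge1 : (1 <= B)%N)
  (B_ge : 72 * (rho - 1) <= B%:R)
  (N_ge1 : (1 <= N)%N) :
  let F0 := f x0 - fstar in
  let x (k : nat) (w : Omega) :=
    clipSGD G eta c x0 (fun j i => xi j i w) k in
  (\big[Order.min/+oo]_(k < N) 'E_P[fun w => l2norm (grad f (x k w))] <=
   (Num.sqrt (18 * F0 / (eta * N%:R)) + 18 * F0 / (eta * c * N%:R))%:E)%E.
Proof.
pose F0 := f x0 - fstar; pose x := iterate P G xi eta c x0.
suff : (\big[Order.min/+oo]_(k < N) 'E_P[fun w => l2norm (grad f (x k w))] <=
    (Num.sqrt (18 * F0 / (eta * N%:R)) + 18 * F0 / (eta * c * N%:R))%:E)%E by [].
have [mG _] := G_grad.
have [_ fge] := f_min.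
have [law indep] := xi_iid.
have etaL : eta * (9 * (L0 + L1 * c)) <= 1.
  rewrite -lee_inve//.
  by rewrite mulr_ge0// addr_ge0// mulr_ge0// ltW.
have pair_indep k (i j : 'I_B) : i != j ->
    forall A A', measurable A -> measurable A' ->
    (P (xi k i @^-1` A `&` xi k j @^-1` A') =
     P (xi k i @^-1` A) * P (xi k j @^-1` A'))%E.
  move=> ij A A' mA mA'.
  apply: (cylinder_independent P _ [set (k, i)] [set (k, j)] indep).
  - apply/seteqP; split=> // z [/= ->] [] ijE.
    by rewrite ijE eqxx in ij.
  - exact: (cylinder_preimage (fun ki => xi ki.1 ki.2 : Omega -> Xi) _ (k, i)).
  - exact: (cylinder_preimage (fun ki => xi ki.1 ki.2 : Omega -> Xi) _ (k, j)).
pose gap (y : borel_rV R d) := ((f y - fstar)%:E : \bar R).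
pose a (y : borel_rV R d) := l2norm (grad f y).
pose phi (y : borel_rV R d) := shrink c (a y) * a y ^+ 2.
have mf := differentiable_measurable_rV f f_diff.
have mgap : measurable_fun setT gap by apply/measurable_EFinP; exact: measurable_funB.
have gap0 y : (0 <= gap y)%E by rewrite lee_fin subr_ge0.
have ma : measurable_fun setT a.
  by apply: measurable_l2norm => i; exact: (measurable_grad_coord f L0 L1).
have phi0 y : 0 <= phi y by rewrite mulr_ge0 ?sqr_ge0// shrink_ge0.
have mphi : measurable_fun setT phi.
  apply: measurable_funM; last exact: measurable_funX.
  exact: (measurableT_comp (measurable_shrink c c_gt0)).
have mx k : @measurable_fun _ _ Omega (borel_rV R d) setT (x k).
  exact: (measurable_iterate P G xi eta c x0 mG c_gt0).
have mphix k : measurable_fun setT (fun w => (phi (x k w))%:E).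
  by apply/measurable_EFinP; exact: (measurableT_comp mphi (mx k)).
have eta2 : 0 <= eta / 2 by rewrite divr_ge0// ltW.
have decr k : (\int[P]_w gap (x k.+1 w) +
    (eta / 2)%:E * \int[P]_w (phi (x k w))%:E <= \int[P]_w gap (x k w))%E.
  rewrite (expectation_next P G xi eta c x0 mG c_gt0 indep k gap mgap gap0).
  pose nxt (y : borel_rV R d) :=
    (\int[P]_w' gap (clip_step G eta c y ((xi k)^~ w')))%E.
  have mnxt : measurable_fun setT nxt.
    pose h (z : borel_rV R d * Omega) :=
      gap (clip_step G eta c z.1 (fun i => xi k i z.2)).
    have mh : measurable_fun [set: (borel_rV R d * Omega)%type] h.
      apply: (measurableT_comp mgap).
      apply: (measurable_clip_step G eta c mG c_gt0 fst (fun i z => xi k i z.2)) => // i.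
      exact: measurableT_comp.
    have h0 z : (0 <= h z)%E by exact: gap0.
    exact: (measurable_fun_fubini_tonelli_F (m2 := P) _ mh h0).
  have nxt0 y : (0 <= nxt y)%E by exact: integral_ge0.
  have mnxtx : measurable_fun setT (fun w => nxt (x k w)).
    exact: (measurableT_comp mnxt (mx k)).
  rewrite -ge0_integralZl_EFin//; last by move=> w _; rewrite lee_fin.
  rewrite -ge0_integralD//; last 3 first.
  - by move=> w _; exact: nxt0.
  - by move=> w _; rewrite mule_ge0// lee_fin.
  - exact: measurable_funeM.
  apply: ge0_le_integral => //.
  - move=> w _; apply: adde_ge0; first exact: nxt0.
    by rewrite mule_ge0// lee_fin.
  - by apply: emeasurable_funD => //; exact: measurable_funeM.
  - exact: (measurableT_comp mgap (mx k)).
  - move=> w _; rewrite -EFinM.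
    by apply: (expected_descent D P f G (xi k) fstar L0 L1 rho) => //; exact: pair_indep.
have tel := telescope_le _ _ decr N.
have gapF0 : (\int[P]_w gap (x 0%N w) = F0%:E)%E
  by exact: (probability_integral_cst P F0).
have N0 : 0 < N%:R :> R by rewrite ltr0n.
have sum_phi : (\sum_(k < N) \int[P]_w (phi (x k w))%:E <= (2 * F0 / eta)%:E)%E.
  have : ((eta / 2)%:E * \sum_(k < N) \int[P]_w (phi (x k w))%:E <= F0%:E)%E.
    rewrite -gapF0 ge0_sume_distrr; last first.
      by move=> k _; apply: integral_ge0 => w _; rewrite lee_fin.
    apply: le_trans tel; rewrite leeDr//.
    by apply: integral_ge0.
  have eta2' : 0 < eta / 2 by rewrite divr_gt0.
  rewrite -lee_pdivlMl// -EFinM => /le_trans; apply.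
  by rewrite lee_fin le_eqVlt; apply/orP; left; apply/eqP; field; rewrite gt_eqF.
(* the minimum is at most each of the N terms, hence at most their average *)
set A := (\big[_/_]_(k < N) _)%E.
have AE k : (k < N)%N -> (A <= \int[P]_w (a (x k w))%:E)%E.
  move=> kN; rewrite /A; apply: le_trans (bigmin_le _ (Ordinal kN) _) _.
  by rewrite unlock.
have A_le t : 0 < t ->
    (A <= (((2 * t)^-1 + c^-1) * (2 * F0 / (eta * N%:R)) + t / 2)%:E)%E.
  move=> t0; set C := (2 * t)^-1 + c^-1.
  have C0 : 0 <= C by rewrite addr_ge0// invr_ge0 ?mulr_ge0// ltW.
  have each k : (k < N)%N ->
      (A <= C%:E * \int[P]_w (phi (x k w))%:E + (t / 2)%:E)%E.
    move=> kN; apply: le_trans (AE k kN) _.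
    rewrite -(probability_integral_cst P (t / 2)) -ge0_integralZl_EFin//; last first.
      by move=> w _; rewrite lee_fin.
    have t20 : 0 <= t / 2 by rewrite divr_ge0// ltW.
    rewrite -ge0_integralD//; last 2 first.
    - by move=> w _; rewrite mule_ge0// lee_fin.
    - exact: measurable_funeM.
    apply: ge0_le_integral => //.
    - by move=> w _; rewrite lee_fin l2norm_ge0.
    - by apply/measurable_EFinP; exact: (measurableT_comp ma (mx k)).
    - by apply: emeasurable_funD => //; exact: measurable_funeM.
    - move=> w _; rewrite -EFinM -EFinD lee_fin.
      by apply: le_shrink_sqr => //; exact: l2norm_ge0.
  have : (N%:R%:E * A <= (C * (2 * F0 / eta) + N%:R * (t / 2))%:E)%E.
    rewrite EFinD EFinM [(N%:R * _)%:E]EFinM.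
    apply: (@le_trans _ _ (\sum_(k < N) (C%:E * \int[P]_w (phi (x k w))%:E + (t / 2)%:E))%E).
      have -> : (N%:R%:E * A = \sum_(k < N) A)%E.
        by rewrite sumr_const card_ord mule_natl.
      by apply: lee_sum => k _; exact: each.
    rewrite big_split/= -ge0_sume_distrr; last first.
      by move=> k _; apply: integral_ge0 => w _; rewrite lee_fin.
    apply: leeD; first by rewrite lee_wpmul2l// lee_fin.
    by rewrite sumr_const card_ord mule_natl.
  rewrite -lee_pdivlMl// -EFinM => /le_trans; apply.
  rewrite lee_fin le_eqVlt; apply/orP; left; apply/eqP; rewrite -/C.
  by field; rewrite !gt_eqF.
(* t = sqrt S would be optimal but vanishes with S, hence the slack e *)
apply/lee_addgt0Pr => e e0.
set S := 18 * F0 / (eta * N%:R).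
have F00 : 0 <= F0 by rewrite subr_ge0.
have S0 : 0 <= S by rewrite divr_ge0 ?mulr_ge0// ltW.
have t0 : 0 < Num.sqrt S + e by rewrite ltr_wpDl// sqrtr_ge0.
apply: le_trans (A_le _ t0) _; rewrite -EFinD lee_fin.
have -> : 18 * F0 / (eta * c * N%:R) = c^-1 * S.
  by rewrite /S; field; rewrite !gt_eqF.
have -> : 2 * F0 / (eta * N%:R) = S / 9.
  by rewrite /S; field; rewrite !gt_eqF.
set r := Num.sqrt S in t0 *.
have r0 : 0 <= r by exact: sqrtr_ge0.
have Sr : S = r ^+ 2 by rewrite sqr_sqrtr.
have h1 : (2 * (r + e))^-1 * (S / 9) <= r / 18.
  rewrite mulrC ler_pdivrMr ?mulr_gt0// Sr.
  have : 0 <= r * e by rewrite mulr_ge0// ltW.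
  lra.
have h2 : 0 <= c^-1 * S by rewrite mulr_ge0// invr_ge0 ltW.
rewrite mulrDl; lra.
Qed.
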